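(* If ${\rm DHL}^*(5;2)$ holds, then for every positive integer $k$ with $30\mid k$ the equation $\phi(n+k)=\phi(n)$ has infinitely many solutions $n\in\mathbb{N}$. If ${\rm DHL}^*(4;2)$ holds, then for every positive integer $k$ with $6\mid k$ the equation $\phi(n+k)=\phi(n)$ has infinitely many solutions $n\in\mathbb{N}$.
   Context: $\phi$ is Euler's totient function. A collection of linear forms $(a_1n+b_1,\ldots,a_Kn+b_K)$ with integer coefficients is called admissible if $a_i>0$ for each $i$, the forms are pairwise distinct, and there is no prime $p$ dividing the product $(a_1n+b_1)\cdots(a_Kn+b_K)$ for every integer $n$. For positive integers $K\ge m$, the statement ${\rm DHL}^*(K;m)$ means: for every admissible collection of $K$ linear forms $(a_1n+b_1,\ldots,a_Kn+b_K)$ there exist distinct indices $i_1,\ldots,i_m\in\{1,\ldots,K\}$ such that there are infinitely many integers $r$ for which the $m$ numbers $a_{i_1}r+b_{i_1},\ldots,a_{i_m}r+b_{i_m}$ are simultaneously prime. *)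

(* Defs.v *)
From HB Require Import structures.
From mathcomp Require Import all_boot all_order all_algebra.
From mathcomp Require Import classical_sets cardinality.
Set Implicit Arguments.
Unset Strict Implicit.
Unset Printing Implicit Defensive.
Import Order.TTheory GRing.Theory Num.Theory.
Local Open Scope ring_scope.
Local Open Scope classical_set_scope.

(* Primes are positive: -2, -3, -5, ... are not prime. *)
Definition int_prime (z : int) : bool := (0 < z) && prime `|z|%N.

(* [admissible a b]: the collection (a_1 n + b_1, ..., a_K n + b_K). *)
Definition admissible (K : nat) (a b : 'I_K -> int) : Prop :=
  [/\ forall i, 0 < a i,
      forall i j, i <> j -> (a i, b i) <> (a j, b j) &
      ~ exists p : nat, prime p /\
          forall n : int, (p%:Z %| \prod_(i < K) (a i * n + b i))%Z].

(* DHL^*(K; m), meaningful for 0 < m <= K; the indices are chosen before r. *)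
Definition DHLstar (K m : nat) : Prop :=
  forall a b : 'I_K -> int, admissible a b ->
  exists i : 'I_m -> 'I_K, injective i /\
    infinite_set [set r : int | forall j : 'I_m,
                                  int_prime (a (i j) * r + b (i j))].

(* Main.v *)
(* If p = us + 1 and q = vs + 1 are primes, u < v and c(v - u) = k, then
   n = cuq satisfies n + k = cvp.  When moreover every prime factor of uv
   divides c, phi(cu) = u phi(c) and phi(cv) = v phi(c), so that for large s
   phi(n) = u phi(c) vs = v phi(c) us = phi(n + k).  For forms an + 1, bn + 1
   this applies with u = a/g, v = b/g, s = gr, g = gcd(a, b).  For every two
   coefficients among 1, 2, 3, 4 a suitable c exists as soon as 6 | k, and
   among 1, 2, 3, 4, 6 as soon as 30 | k; forms an + 1 are admissible since
   they all equal 1 at n = 0. *)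
Require Import Defs.
From mathcomp Require Import all_boot all_order all_algebra.
From mathcomp Require Import classical_sets cardinality.
From mathcomp Require Import boolp zify.
Set Implicit Arguments.
Unset Strict Implicit.
Unset Printing Implicit Defensive.

(** Write c = m p^e with p prime to m; then e >= 1, and phi(p^(e+1)) = p phi(p^e). *)
Lemma totient_mul_prime c p : 0 < c -> prime p -> p %| c ->
  totient (c * p) = totient c * p.
Proof.
move=> c0 pp pc.
have [m mp ->] := pfactor_coprime pp c0.
have l0 : 0 < logn p c by rewrite logn_gt0 mem_primes pp c0.
rewrite -mulnA -expnSr !totient_coprime ?coprimeXr 1?coprime_sym //.
rewrite !totient_pfactor //=.
by rewrite -[in LHS](prednK l0) expnSr !mulnA.
Qed.

(** Strong induction on u, splitting off its least prime factor p: since p divides c, it also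
    divides c times the remaining cofactor. *)
Lemma totient_mul_primes_dvd c u : 0 < c -> 0 < u ->
  {in primes u, forall p, p %| c} -> totient (c * u) = totient c * u.
Proof.
move=> c0; elim/ltn_ind: u => u IH u0 uc.
have [u1|u1] := leqP u 1.
  have -> : u = 1 by lia.
  by rewrite !muln1.
have pp := pdiv_prime u1.
have /dvdnP[w uE] := pdiv_dvd u.
move: (pdiv u) pp uE => p pp uE; rewrite {}uE in u0 u1 uc IH *.
have w0 : 0 < w by lia.
have pc : p %| c.
  by apply: uc; rewrite mem_primes pp u0 dvdn_mull.
rewrite mulnA totient_mul_prime ?muln_gt0 ?c0 ?dvdn_mulr //.
rewrite IH ?mulnA //; first by rewrite ltn_Pmulr // prime_gt1.
move=> q; rewrite mem_primes => /and3P[qp _ qw].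
by apply: uc; rewrite mem_primes qp u0 dvdn_mulr.
Qed.

Lemma totient_mul_large_prime m p : 0 < m < p -> prime p ->
  totient (m * p) = totient m * p.-1.
Proof.
move=> /andP[m0 mp] pp; rewrite totient_coprime ?(totient_prime pp) //.
by rewrite coprime_sym prime_coprime // gtnNdvd.
Qed.

Lemma totient_shift_eq c u v s : 0 < c -> 0 < u < v -> c * v < s ->
  {in primes (u * v), forall p, p %| c} ->
  prime (u * s).+1 -> prime (v * s).+1 ->
  totient (c * u * (v * s).+1 + c * (v - u)) = totient (c * u * (v * s).+1).
Proof.
move=> c0 /andP[u0 uv] cvs uvc pu pv.
have v0 : 0 < v by lia.
have -> : c * u * (v * s).+1 + c * (v - u) = c * v * (u * s).+1.
  by rewrite mulnBr; nia.
have uc : {in primes u, forall p, p %| c}.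
  by move=> p pu'; apply: uvc; rewrite primesM // pu'.
have vc : {in primes v, forall p, p %| c}.
  by move=> p pv'; apply: uvc; rewrite primesM // pv' orbT.
have us : s <= u * s by rewrite leq_pmull.
have vs : s <= v * s by rewrite leq_pmull.
have cuv : c * u <= c * v by rewrite leq_mul2l (ltnW uv) orbT.
(* As s > cv > cu, each of the two primes exceeds its cofactor and is thus coprime to it. *)
rewrite (totient_mul_large_prime _ pu) ?(totient_mul_large_prime _ pv) /=.
- by rewrite !totient_mul_primes_dvd //; lia.
- by rewrite muln_gt0 c0 u0 /=; lia.
- by rewrite muln_gt0 c0 v0 /=; lia.
Qed.

(** For a < b, this says that c = m / (v - u) is a suitable multiplier for the shift m. Being
    boolean, it can be evaluated on explicit coefficients. *)
Definition totient_compatible (m a b : nat) : bool :=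
  let u := a %/ gcdn a b in let v := b %/ gcdn a b in
  (v - u %| m) && all (fun p => p %| m %/ (v - u)) (primes (u * v)).

(** Compatibility with m passes to a multiple k = l m: replace c by l c, which keeps all prime
    divisors of c. *)
Lemma totient_compatible_eq m k a b r :
  0 < a < b -> m %| k -> 0 < k -> totient_compatible m a b -> k * b < r ->
  prime (a * r).+1 -> prime (b * r).+1 ->
  exists2 n, r < n & totient (n + k) = totient n.
Proof.
rewrite /totient_compatible => /andP[a0 ab] /dvdnP[l kE] k0 /andP[dm pm].
move=> kr pa pb.
have b0 : 0 < b by lia.
have g0 : 0 < gcdn a b by rewrite gcdn_gt0 a0.
have /dvdnP[u aE] := dvdn_gcdl a b; have /dvdnP[v bE] := dvdn_gcdr a b.
move: (gcdn a b) g0 aE bE dm pm => g g0 aE bE.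
rewrite {}aE {}bE in a0 ab b0 kr pa pb *; rewrite !mulnK //.
move=> /dvdnP[c mE]; rewrite {}mE in kE *.
have uv : u < v by nia.
rewrite mulnK ?subn_gt0 // => /allP pm.
have kE' : k = l * c * (v - u) by rewrite kE mulnA.
have c0 : 0 < l * c by nia.
have u0 : 0 < u by nia.
rewrite -mulnA in pa; rewrite -mulnA in pb.
have ck : l * c <= k by rewrite kE' leq_pmulr // subn_gt0.
(* This is n = c u q for the multiplier l c and s = g r. *)
exists (l * c * u * (v * (g * r)).+1).
  have cu0 : 0 < l * c * u by rewrite muln_gt0 c0.
  have : r <= v * (g * r) by rewrite mulnA leq_pmull // muln_gt0 g0; lia.
  by move=> rv; apply: leq_trans (leq_pmull _ cu0).
rewrite {1}kE' totient_shift_eq //; first by rewrite u0.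
  (* The size condition on s: l c v <= k b < r <= g r. *)
  have : l * c * v <= k * (v * g) by apply: leq_mul => //; rewrite leq_pmulr.
  have : r <= g * r by rewrite leq_pmull.
  by lia.
by move=> p /pm pc; rewrite dvdn_mull.
Qed.

Lemma unbounded_infinite_nat (A : set nat) :
  (forall N, exists2 n, N < n & A n) -> infinite_set A.
Proof.
move=> AN /finite_seqP[s As].
have [n ns An] := AN (\max_(i <- s) i).
have sn : n \in s by move: An; rewrite As.
by have := @leq_bigmax_seq _ s xpredT id n sn isT; rewrite leqNgt ns.
Qed.

Lemma infinite_int_unbounded (A : set int) : infinite_set A ->
  (forall z, A z -> exists r : nat, z = Posz r) ->
  forall N, exists2 r : nat, N < r & A (Posz r).
Proof.
move=> Ainf Anat N; apply: contrapT => nA; apply: Ainf.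
apply: (@sub_finite_set _ _ [set` map Posz (iota 0 N.+1)]%classic) => [z Az|].
  have [r zr] := Anat z Az.
  rewrite zr; apply: map_f; rewrite mem_iota add0n /= ltnS leqNgt.
  by apply/negP => Nr; apply: nA; exists r; rewrite // -zr.
by apply/finite_seqP; exists (map Posz (iota 0 N.+1)).
Qed.

Section UnitConstantForms.
Import GRing.Theory.

Lemma admissible_unit_constant K (a : 'I_K -> nat) :
  (forall i, 0 < a i) -> injective a ->
  admissible (fun i => Posz (a i)) (fun=> 1%R).
Proof.
move=> a0 ainj; split=> [i|i j ij [/ainj]//|[p [pp /(_ 0%R)]]]; first exact: a0.
rewrite big1; first by rewrite dvdz1 /=; case: p pp => [|[]].
by move=> i _; rewrite mulr0 add0r.
Qed.

(** For z < 0 the value az + 1 is at most 0, hence not prime; so the integers supplied by [DHLstar]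
    are natural numbers here. *)
Lemma int_prime_unit_constant (a : nat) (z : int) : 0 < a ->
  int_prime (Posz a * z + 1)%R ->
  exists2 r : nat, z = Posz r & prime (a * r).+1.
Proof.
rewrite /int_prime => a0; case: z => r /andP[z0 pz]; last by nia.
exists r => //; congr (is_true (prime _)): pz; lia.
Qed.

End UnitConstantForms.

(** Which two forms become prime together is not known in advance, so compatibility is demanded of
    all pairs of coefficients. *)
Lemma DHLstar_totient_eq (s : seq nat) (m k : nat) :
  uniq s -> all (ltn 0) s ->
  all2rel (fun a b => (a < b) ==> totient_compatible m a b) s ->
  DHLstar (size s) 2 -> 0 < k -> m %| k ->
  infinite_set [set n : nat | 0 < n /\ totient (n + k) = totient n]%classic.
Proof.
move=> us /allP s0 /allrelP sm dhl k0 mk.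
pose a (i : 'I_(size s)) := nth 0 s i.
have as_ i : a i \in s by rewrite mem_nth.
have a0 i : 0 < a i by exact: s0.
have ainj : injective a.
  by move=> i j /eqP; rewrite nth_uniq // => /eqP/val_inj.
have [i [iinj inf]] := dhl _ _ (admissible_unit_constant a0 ainj).
have ne : a (i ord0) != a (i ord_max).
  by apply/eqP => /ainj/iinj.
apply: unbounded_infinite_nat => N.
(* The threshold serves two ends: r > N yields solutions n > N, and r exceeds k times either
   coefficient. *)
have [|r rN rP] := @infinite_int_unbounded _ inf _
    (N + k * (a (i ord0) + a (i ord_max))).
  by move=> z /(_ ord0)/(int_prime_unit_constant (a0 _))[r -> _]; exists r.
have pr j : prime (a (i j) * r).+1.
  by have [_ [<-]] := int_prime_unit_constant (a0 _) (rP j).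
suff [n rn nP] : exists2 n, r < n & totient (n + k) = totient n.
  by exists n; [lia|split=> //; lia].
have H x y : a (i x) < a (i y) -> k * a (i y) < r ->
    exists2 n, r < n & totient (n + k) = totient n.
  move=> xy kr; apply: (totient_compatible_eq _ mk k0 _ kr (pr x) (pr y)).
    by rewrite a0.
  exact: implyP (sm _ _ (as_ _) (as_ _)) xy.
by case: (ltngtP (a (i ord0)) (a (i ord_max))) ne => // h _; apply: H h _; lia.
Qed.

Theorem theorem3 :
  (DHLstar 5 2 ->
     forall k : nat, 0 < k -> 30 %| k ->
       infinite_set [set n : nat | 0 < n /\ totient (n + k) = totient n]%classic)
  /\
  (DHLstar 4 2 ->
     forall k : nat, 0 < k -> 6 %| k ->
       infinite_set [set n : nat | 0 < n /\ totient (n + k) = totient n]%classic).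
Proof.
split=> dhl k.
  (* The conditions on the list hold by evaluation. The factor 5 of 30 serves the pair (1, 6), where
     v - u = 5 and c = 6. *)
  exact: (@DHLstar_totient_eq [:: 1; 2; 3; 4; 6] 30).
exact: (@DHLstar_totient_eq [:: 1; 2; 3; 4] 6).
Qed.
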